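(* Let $1\le p<\infty$ and let $T$ be a tree such that the backward shift $B$ is bounded on $\mathbb{H}^p_0(T)$. If $T$ has a leaf, then $B$ is not hypercyclic on $\mathbb{H}^p_0(T)$.
   Context: $\mathbb{N}_0=\{0,1,2,\dots\}$. A tree $T$ means a connected graph with no cycles, with countably infinitely many vertices, locally finite (every vertex has finitely many adjacent vertices), with a distinguished vertex $\mathrm{o}$ called the root. For a vertex $v$, $|v|$ is the number of edges in the unique path between $\mathrm{o}$ and $v$; $v$ is in level $n$ if $|v|=n$, and $\gamma(n)$ is the number of vertices in level $n$. For $v\neq \mathrm{o}$, $\operatorname{par}(v)$ (the parent of $v$) is the unique vertex $w$ on the path from $v$ to $\mathrm{o}$ with $|w|=|v|-1$; $\operatorname{Chi}(v)$ is the set of children of $v$, i.e. of vertices $u$ with $\operatorname{par}(u)=v$. A leaf is a vertex $v$ with $\operatorname{Chi}(v)=\varnothing$. $\mathcal{F}$ is the vector space of all complex-valued functions on the set of vertices of $T$. For $f\in\mathcal{F}$ and $n\in\mathbb{N}_0$, $M_p(n,f):=\left(\frac{1}{\gamma(n)}\sum_{|v|=n}|f(v)|^p\right)^{1/p}$. The little Hardy space $\mathbb{H}^p_0(T)$ is the set of $f\in\mathcal{F}$ with $\lim_{n\to\infty}M_p(n,f)=0$; it is a Banach space with the norm $\|f\|:=\sup_{n\in\mathbb{N}_0}M_p(n,f)$. The backward shift $B:\mathcal{F}\to\mathcal{F}$ is the linear map $(Bf)(v)=\sum_{w\in\operatorname{Chi}(v)}f(w)$ (empty sums are $0$). ''$B$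 is bounded on $\mathbb{H}^p_0(T)$'' means that $B$ maps $\mathbb{H}^p_0(T)$ into itself and is a bounded linear operator there. An operator $A$ on a Banach space $\mathcal{B}$ is hypercyclic if there is $x\in\mathcal{B}$ whose orbit $\{x,Ax,A^2x,\dots\}$ is dense in $\mathcal{B}$. *)

(* Defs.v *)
From HB Require Import structures.
From mathcomp Require Import all_boot all_order all_algebra finmap.
From mathcomp Require Import all_classical all_reals all_analysis.
From mathcomp Require Import complex.

Set Implicit Arguments.
Unset Strict Implicit.
Unset Printing Implicit Defensive.

Import Order.TTheory GRing.Theory Num.Theory.
Import numFieldNormedType.Exports.
Import ComplexField.Normc.

Local Open Scope classical_set_scope.
Local Open Scope ring_scope.

(* In [tree_acyclic], the duplicate-free cyclic sequences of size at most 2 are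
   the empty one and the edges traversed back and forth; a cycle of the graph
   is one of size at least 3. *)
Record rootedTree := RootedTree {
  vertex :> choiceType;
  adj : rel vertex;
  root : vertex;
  adj_sym : symmetric adj;
  adj_irr : irreflexive adj;
  tree_connected : forall u v, exists s, path adj u s /\ last u s = v;
  tree_acyclic : forall c, cycle adj c -> uniq c -> (size c <= 2)%N;
  tree_locally_finite : forall v, finite_set [set w | adj v w];
  tree_countable : countable [set: vertex];
  tree_infinite : infinite_set [set: vertex]
}.

Section tree.
Variable T : rootedTree.
Implicit Types (u v w : T) (s : seq T).

Definition simple_path u v s :=
  [&& path (@adj T) u s, uniq (u :: s) & last u s == v].

Lemma simple_path_exists v : exists s, simple_path (root T) v s.
Proof.
have [s [ps <-]] := tree_connected (root T) v.
by case/shortenP: ps => s' p' u' _; exists s'; apply/and3P; split.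
Qed.

Lemma simple_path_unique u v s1 s2 :
  simple_path u v s1 -> simple_path u v s2 -> s1 = s2.
Proof.
elim: s1 u s2 => [|x s1 IH] u [|y s2] //.
- move=> /and3P[_ _ /eqP uv] /and3P[_ /= /andP[+ _] /eqP e].
  by move: e; rewrite -uv /= => {1}<-; rewrite mem_last.
- move=> /and3P[_ /= /andP[+ _] /eqP e] /and3P[_ _ /eqP uv].
  by move: e; rewrite -uv /= => {1}<-; rewrite mem_last.
have [->|xy] := eqVneq x y.
  move=> /and3P[/= /andP[_ p1] /andP[_ n1] l1].
  move=> /and3P[/= /andP[_ p2] /andP[_ n2] l2].
  by congr cons; apply: (IH y); apply/and3P; split.
set q1 := x :: s1; set q2 := y :: s2 => /and3P[p1 n1 /eqP l1] /and3P[p2 n2 /eqP l2].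
exfalso; have {}xy : head u q1 != head u q2 by [].
have h : has (mem q2) q1.
  apply/hasP; exists v; first by rewrite -l1 /= mem_last.
  by rewrite -l2 /= mem_last.
case: (split_find h) p1 n1 xy l1 => z a1 b1 zq2 disj p1 n1 xy _.
have {}zq2 : z \in q2 by [].

case: (path.splitP zq2) p2 n2 disj xy {l2} => a2 b2 p2 n2 disj xy.
suff /tree_acyclic : cycle (@adj T) (u :: rcons a1 z ++ rev a2).
  have un : uniq (u :: rcons a1 z ++ rev a2).
    move: n1 n2; rewrite /= !cat_uniq !mem_cat !mem_rcons !rcons_uniq mem_rev.
    rewrite rev_uniq !inE !negb_or -!andbA.
    move=> /and5P[-> -> _ -> /andP[-> _]] /and5P[_ -> _ za2 /andP[-> _]] /=.
    rewrite andbT; apply/hasPn => w; rewrite mem_rev => wa2 /=.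
    rewrite mem_rcons inE negb_or; apply/andP; split.
      by apply: contraNneq za2 => <-.
    apply: contra disj => wa1; apply/hasP; exists w => //=.
    by rewrite mem_cat mem_rcons inE wa2 orbT.
  move=> /(_ un); rewrite /= size_cat size_rcons size_rev.
  case: a1 {h p1 n1 disj un} xy => [|? ?]; last by rewrite /= !addSn.
  by case: a2 {zq2 p2 n2} => [|? ?] //=; rewrite eqxx.
move: p1 p2; rewrite /= rcons_cat !cat_path last_rcons => /andP[-> _] /andP[+ _].
rewrite -(eq_path (e := fun w w' => adj w' w)); last by move=> ? ?; exact: adj_sym.
by rewrite -rev_path last_rcons belast_rcons rev_cons.
Qed.

(* The choice is immaterial by [simple_path_unique]; the root itself is not
   listed, so the size of [root_path v] is its number of edges. *)
Definition root_path v : seq T := xchoose (simple_path_exists v).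

Lemma root_pathP v : simple_path (root T) v (root_path v).
Proof. exact: xchooseP (simple_path_exists v). Qed.

Definition depth v : nat := size (root_path v).

Definition is_parent w v :=
  [/\ v != root T, w \in root T :: root_path v & (depth w).+1 = depth v].

Definition children v : set T := [set u | is_parent v u].

Definition leaf v := children v = set0.

Definition level n : set T := [set v | depth v = n].

Lemma level_finite n : finite_set (level n).
Proof.
pose S n u := [set v | exists s, [/\ path (@adj T) u s, size s = n & last u s = v]].
suff fS : finite_set (S n (root T)).
  apply: sub_finite_set fS => v /= vn; exists (root_path v).
  by have /and3P[? _ /eqP ?] := root_pathP v; split.
elim: n (root T) => [|n IH] u.
  apply: sub_finite_set (finite_set1 u) => v /= [[|? ?] [_ //= _ ->]] //.
have fb : finite_set (\bigcup_(w in [set w | adj u w]) S n w).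
  by apply: bigcup_finite => [|w _]; [exact: tree_locally_finite | exact: IH].
apply: sub_finite_set fb => v /= [[|w s] [//= /andP[uw ps] [ns] l]].
by exists w => //; exists s.
Qed.

Lemma children_finite v : finite_set (children v).
Proof.
apply: sub_finite_set (level_finite (depth v).+1) => u /= -[_ _ ->]; done.
Qed.

End tree.

(* [fset_set] is the identity on finite sets and sends infinite ones to the
   empty set; [level_finite] and [children_finite] exclude the latter below. *)
Definition gamma (T : rootedTree) (n : nat) : nat := #|` fset_set (@level T n)|%fset.

Section hardy.
Variables (R : realType) (T : rootedTree).

Definition tree_fun : Type := T -> R[i].
HB.instance Definition _ := GRing.Lmodule.copy tree_fun (T -> (R[i])^o).

Definition backward_shift (f : tree_fun) : tree_fun :=
  fun v => \sum_(w <- fset_set (children v)) f w.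

Lemma backward_shift_is_linear : linear backward_shift.
Proof.
move=> a f g; apply/funext => v.
rewrite /backward_shift (eq_bigr (fun w => a * f w + g w))// big_split/=.
by rewrite -mulr_sumr.
Qed.

HB.instance Definition _ :=
  GRing.isLinear.Build R[i] tree_fun tree_fun *:%R backward_shift
    backward_shift_is_linear.

Variable p : R.
Implicit Types f g : tree_fun.

Definition Mp (n : nat) f : R :=
  ((gamma T n)%:R^-1 *
   \sum_(v <- fset_set (@level T n)) normc (f v) `^ p) `^ p^-1.

Definition in_hardy0 : {pred tree_fun} :=
  [pred f | `[< Mp ^~ f @ \oo --> (0 : R) >]].

Definition hardy_norm f : R := sup (range (Mp ^~ f)).

Hypothesis p1 : 1 <= p.

Let p0 : 0 < p. Proof. exact: lt_le_trans p1. Qed.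

Lemma normc_ge0 (z : R[i]) : 0 <= normc z.
Proof. by case: z => a b; exact: sqrtr_ge0. Qed.

Lemma Mp_ge0 n f : 0 <= Mp n f.
Proof. exact: powR_ge0. Qed.

Lemma Mp_sum_ge0 n f :
  0 <= (gamma T n)%:R^-1 * \sum_(v <- fset_set (@level T n)) normc (f v) `^ p.
Proof.
by rewrite mulr_ge0 ?invr_ge0 ?ler0n ?sumr_ge0// => v _; exact: powR_ge0.
Qed.

Lemma Mp_powR n f :
  Mp n f `^ p =
  (gamma T n)%:R^-1 * \sum_(v <- fset_set (@level T n)) normc (f v) `^ p.
Proof. by rewrite /Mp -powRrM mulVf ?gt_eqF// powRr1// Mp_sum_ge0. Qed.

Lemma Mp_le n f (a : R) : 0 <= a ->
  (gamma T n)%:R^-1 *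
    \sum_(v <- fset_set (@level T n)) normc (f v) `^ p <= a `^ p -> Mp n f <= a.
Proof.
move=> a0; rewrite -Mp_powR => h.
rewrite leNgt; apply/negP => /(gt0_ltr_powR p0); rewrite !nnegrE.
by move=> /(_ a0 (Mp_ge0 _ _)); rewrite ltNge h.
Qed.

Lemma MpD n f g : Mp n (f + g) <= Mp n f + Mp n g.
Proof.
suff le_ab a b : 0 < a -> 0 < b -> Mp n f < a -> Mp n g < b ->
    Mp n (f + g) <= a + b.
  apply/ler_addgt0Pr => e e0; have e2 : 0 < e / 2 by rewrite divr_gt0.
  rewrite [e]splitr addrACA.
  by apply: le_ab; rewrite ?ltrDl// ltr_wpDl ?Mp_ge0.
move=> a0 b0 Ma Mb.
have ab0 : 0 < a + b by exact: addr_gt0.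
have le_powR f' c : Mp n f' < c -> (gamma T n)%:R^-1 *
    \sum_(v <- fset_set (@level T n)) normc (f' v) `^ p <= c `^ p.
  move=> fc; rewrite -Mp_powR.
  apply: (ge0_ler_powR (ltW p0)); rewrite ?nnegrE ?Mp_ge0 ?(ltW fc)//.
  exact: le_trans (Mp_ge0 n f') (ltW fc).
apply: Mp_le (ltW ab0) _.
pose t := a / (a + b).
have t01 : 0 <= t <= 1.
  apply/andP; split; first by rewrite divr_ge0 ?ltW.
  by rewrite /t ler_pdivrMr// mul1r lerDl ltW.
have tab : t * (a + b) = a by rewrite /t divfK ?gt_eqF.
have tab' : (1 - t) * (a + b) = b.
  by rewrite mulrBl tab mul1r addrAC subrr add0r.
have powRV (c : R) : 0 < c -> c^-1 `^ p = (c `^ p)^-1.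
  by move=> c0; rewrite -powR_inv1 ?ltW// powRAC powR_inv1 ?powR_ge0.
have pw v : normc ((f + g) v) `^ p <= (a + b) `^ p *
    (t * (normc (f v) `^ p / a `^ p) + (1 - t) * (normc (g v) `^ p / b `^ p)).
  have -> : (f + g) v = f v + g v by [].
  have le1 : normc (f v + g v) <= normc (f v) + normc (g v).
    exact: (@le_normcD R (f v) (g v)).
  move: (normc_ge0 (f v)) (normc_ge0 (g v)) le1.
  move: (normc (f v)) (normc (g v)) => x y x0 y0 le1.
  apply: (@le_trans _ _ ((x + y) `^ p)).
    by apply: (ge0_ler_powR (ltW p0)); rewrite ?nnegrE ?normc_ge0 ?addr_ge0.
  have -> : x + y = (a + b) * (t * (x / a) + (1 - t) * (y / b)).
    rewrite mulrDr (mulrA _ t) (mulrA _ (1 - t)) (mulrC _ t) (mulrC _ (1 - t)).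
    by rewrite tab tab' [a * _]mulrC [b * _]mulrC !divfK ?gt_eqF.
  have xa0 : 0 <= x / a by rewrite divr_ge0 // ltW.
  have yb0 : 0 <= y / b by rewrite divr_ge0 // ltW.
  have [t_0 t_1] := andP t01.
  have c0 : 0 <= t * (x / a) + (1 - t) * (y / b).
    by apply: addr_ge0; apply: mulr_ge0; rewrite // subr_ge0.
  rewrite (powRM _ (ltW ab0) c0).
  rewrite ler_wpM2l ?powR_ge0//.
  have ia0 : 0 <= a^-1 by rewrite invr_ge0 ltW.
  have ib0 : 0 <= b^-1 by rewrite invr_ge0 ltW.
  rewrite -(powRV _ a0) -(powRV _ b0) -(powRM p x0 ia0) -(powRM p y0 ib0).
  apply: (convex_powR p1 (Itv01 t_0 t_1)).
  - by rewrite inE/= in_itv/= xa0.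
  - by rewrite inE/= in_itv/= yb0.
have pos0 : 0 <= (gamma T n)%:R^-1 :> R by rewrite invr_ge0.
apply: (@le_trans _ _ ((gamma T n)%:R^-1 * \sum_(v <- fset_set (@level T n))
    ((a + b) `^ p * (t * (normc (f v) `^ p / a `^ p) +
                     (1 - t) * (normc (g v) `^ p / b `^ p))))).
  by rewrite ler_wpM2l//; apply: ler_sum => v _; exact: pw.
rewrite -mulr_sumr mulrCA -[leRHS]mulr1 ler_wpM2l ?powR_ge0//.
rewrite big_split/= -!mulr_sumr -!mulr_suml mulrDr.
rewrite (mulrCA _ t) (mulrCA _ (1 - t)) !(mulrA (gamma T n)%:R^-1).
rewrite -[leRHS](subrKC t).
have [t_0 t_1] := andP t01.
by apply: lerD; rewrite ler_piMr ?subr_ge0// ler_pdivrMr ?powR_gt0// mul1r le_powR.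
Qed.

Lemma MpZ n (k : R[i]) f : Mp n (k *: f) = normc k * Mp n f.
Proof.
rewrite /Mp (eq_bigr (fun v => normc k `^ p * normc (f v) `^ p)); last first.
  by move=> v _; rewrite [(k *: f) v]/(k * f v) normcM powRM ?normc_ge0.
rewrite -mulr_sumr mulrCA powRM ?powR_ge0 ?Mp_sum_ge0//.
by rewrite -powRrM mulfV ?gt_eqF// powRr1 ?normc_ge0.
Qed.

Lemma Mp0 n : Mp n 0 = 0.
Proof. by rewrite -(scale0r (0 : tree_fun)) MpZ normc0 mul0r. Qed.

Lemma in_hardy0_submod_closed : submod_closed in_hardy0.
Proof.
split.
  apply/asboolP; rewrite (_ : Mp ^~ 0 = cst 0); first exact: cvg_cst.
  by apply/funext => n; rewrite Mp0.
move=> k f g /asboolP fH /asboolP gH; apply/asboolP.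
apply: (@squeeze_cvgr _ _ _ _ (cst 0)
   (fun n => normc k * Mp n f + Mp n g)).
- by near=> n; rewrite Mp_ge0/= (le_trans (MpD _ _ _))// MpZ.
- exact: cvg_cst.
- have := cvgD (cvgM (cvg_cst (normc k)) fH) gH.
  by rewrite mulr0 addr0; apply.
Unshelve. all: by end_near. Qed.

HB.instance Definition _ :=
  GRing.isSubmodClosed.Build _ _ in_hardy0 in_hardy0_submod_closed.

(* The exponent bound is a parameter of the type because the norm below needs
   it for the triangle inequality. *)
Record littleHardy (q1 : 1 <= p) : Type := LittleHardy {
  hardy_val :> tree_fun;
  hardy_valP : hardy_val \in in_hardy0
}.

HB.instance Definition _ := [isSub for @hardy_val p1].
HB.instance Definition _ := [Choice of littleHardy p1 by <:].
HB.instance Definition _ := [SubChoice_isSubLmodule of littleHardy p1 by <:].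

Implicit Types F G : littleHardy p1.

Lemma hardy_has_sup F : has_sup (range (Mp ^~ (F : tree_fun))).
Proof.
split; first by exists (Mp 0 F); exists 0%N.
have /asboolP/cvgP/cvg_seq_bounded[M [_ h]] := hardy_valP F.
exists (M + 1) => _ [n _ <-].
by apply: le_trans (h (M + 1) _ n I); rewrite ?ltrDl// ler_norm.
Qed.

Lemma Mp_le_norm n F : Mp n F <= hardy_norm F.
Proof. by apply: ub_le_sup; [have [] := hardy_has_sup F | exists n]. Qed.

Lemma hardy_norm_le F (a : R) : (forall n, Mp n F <= a) -> hardy_norm F <= a.
Proof.
move=> h; apply: ge_sup; first by have [] := hardy_has_sup F.
by move=> _ [n _ <-].
Qed.

Lemma normc_powR_le f v :
  normc (f v) `^ p <= (gamma T (depth v))%:R * Mp (depth v) f `^ p.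
Proof.
have vl : v \in fset_set (@level T (depth v)).
  by rewrite in_fset_set ?inE//; exact: level_finite.
have g0 : (gamma T (depth v))%:R != 0 :> R.
  rewrite pnatr_eq0 /gamma cardfs_eq0.
  by apply/eqP => e; move: vl; rewrite e inE.
rewrite Mp_powR mulrA divff// mul1r (big_rem v)//= lerDl sumr_ge0// => w _.
exact: powR_ge0.
Qed.

Lemma hardy_norm_ge0 F : 0 <= hardy_norm F.
Proof. exact: le_trans (Mp_ge0 0 F) (Mp_le_norm 0 F). Qed.

Lemma hardy_normZ_le (k : R[i]) F :
  hardy_norm (k *: F) <= normc k * hardy_norm F.
Proof.
by apply: hardy_norm_le => n; rewrite MpZ ler_wpM2l ?normc_ge0 ?Mp_le_norm.
Qed.

Lemma hardy_normD F G :
  (hardy_norm (F + G))%:C%C <= (hardy_norm F)%:C%C + (hardy_norm G)%:C%C.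
Proof.
rewrite -rmorphD lecR; apply: hardy_norm_le => n.
by rewrite (le_trans (MpD _ _ _))// lerD ?Mp_le_norm.
Qed.

Lemma hardy_normZ (k : R[i]) F :
  (hardy_norm (k *: F))%:C%C = `|k| * (hardy_norm F)%:C%C.
Proof.
rewrite -[ `|k| ]/((normc k)%:C)%C -rmorphM; congr (_%:C)%C.
apply/eqP; rewrite eq_le hardy_normZ_le andTb.
have [->|k0] := eqVneq k 0; first by rewrite normc0 mul0r hardy_norm_ge0.
have nk0 : normc k != 0 by apply: contra k0 => /eqP/eq0_normc ->.
have nk : 0 < normc k by rewrite lt_neqAle eq_sym nk0 normc_ge0.
have := hardy_normZ_le k^-1 (k *: F).
by rewrite scalerA mulVf// scale1r normcV mulrC ler_pdivlMr// mulrC.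
Qed.

Lemma hardy_norm_eq0 F : (hardy_norm F)%:C%C = 0 -> F = 0.
Proof.
move=> /complexI F0; apply/val_inj/funext => v.
apply: eq0_normc; apply/eqP; rewrite eq_le normc_ge0 andbT.
have M0 : Mp (depth v) F = 0.
  by apply/eqP; rewrite eq_le Mp_ge0 -F0 Mp_le_norm.
have := normc_powR_le F v.
rewrite M0 powR0 ?gt_eqF// mulr0 => h.
have /powR_eq0_eq0 -> // : normc ((F : tree_fun) v) `^ p = 0.
by apply/eqP; rewrite eq_le h powR_ge0.
Qed.

HB.instance Definition _ := Lmodule_isNormed.Build R[i] (littleHardy p1)
  hardy_normD hardy_normZ hardy_norm_eq0.

(* Norms of complex normed modules take values in [R[i]], whence the
   embedding of the real supremum. *)
Lemma hardy_normE F : `|F| = (hardy_norm F)%:C%C.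
Proof. by []. Qed.

Definition shift_invariant :=
  forall f, f \in in_hardy0 -> backward_shift f \in in_hardy0.

Definition hardy_shift (B : shift_invariant) F : littleHardy p1 :=
  @LittleHardy p1 (backward_shift F) (B _ (hardy_valP F)).

Lemma hardy_shift_is_linear (B : shift_invariant) : linear (hardy_shift B).
Proof. by move=> a F G; apply/val_inj; rewrite /= linearP. Qed.

HB.instance Definition _ (B : shift_invariant) :=
  GRing.isLinear.Build R[i] (littleHardy p1) (littleHardy p1) *:%R
    (hardy_shift B) (hardy_shift_is_linear B).

End hardy.

Arguments littleHardy {R} T {p} q1.
Arguments shift_invariant {R} T p.
Arguments hardy_shift {R T p} p1 B F.

Definition bounded_operator (K : numFieldType) (E : normedModType K)
  (A : {linear E -> E}) := exists C : K, forall x, `|A x| <= C * `|x|.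

Definition hypercyclic (K : numFieldType) (E : normedModType K)
  (A : {linear E -> E}) := exists x, dense [set iter n A x | n in [set: nat]].

Arguments bounded_operator {K} E A.
Arguments hypercyclic {K} E A.

(* Main.v *)
Require Import Defs.
From mathcomp Require Import all_boot all_order all_algebra.
From mathcomp Require Import all_classical all_reals all_analysis.
From mathcomp Require Import finmap complex.

Set Implicit Arguments.
Unset Strict Implicit.
Unset Printing Implicit Defensive.

Import Order.TTheory GRing.Theory Num.Theory.
Import numFieldNormedType.Exports.
Import ComplexField.Normc.

Local Open Scope classical_set_scope.
Local Open Scope ring_scope.

(** At a leaf [v] the sum defining the shift is empty, so every iterate of
    order at least one vanishes at [v]: along the orbit of [F], the value at
    [v] is either [F v] or 0 ([hardy_shift_iter_leaf]).  Evaluation at [v] is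
    continuous on the little Hardy space ([normc_powR_hardy_norm]) and takes
    every complex value, on the multiples of the indicator of [v]
    ([vertex_indicator_in_hardy0]).  Hence a multiple of that indicator whose
    value at [v] is far from both [F v] and 0 stays at distance at least 1 from
    the orbit, which is therefore not dense. *)

(** The indicator function of the vertex [v]. *)
Definition vertex_indicator (R : realType) (T : rootedTree) (v : T) :
    tree_fun R T :=
  fun w => (w == v)%:R.

Lemma vertex_indicator_in_hardy0 (R : realType) (p : R) (p1 : 1 <= p)
    (T : rootedTree) (v : T) : vertex_indicator R v \in in_hardy0 p.
Proof.
have p0 : p != 0 by rewrite gt_eqF// (lt_le_trans _ p1).
apply/asboolP; apply: cvg_near_cst; exists (depth v).+1 => // n /= vn.
rewrite /Mp big1_fset ?mulr0 ?powR0 ?invr_neq0// => w.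
rewrite in_fset_set; last exact: level_finite.
rewrite in_setE /= => wn _; rewrite /vertex_indicator.
have [wv|_] := eqVneq w v; first by rewrite -wn wv ltnn in vn.
by rewrite normc0 powR0.
Qed.

(** Evaluation at a vertex is bounded by the Hardy norm. *)
Lemma normc_powR_hardy_norm (R : realType) (p : R) (p1 : 1 <= p)
    (T : rootedTree) (F : littleHardy T p1) (v : T) :
  normc (hardy_val F v) `^ p <=
    (gamma T (depth v))%:R * hardy_norm p F `^ p.
Proof.
apply: le_trans (normc_powR_le p1 F v) _.
rewrite ler_wpM2l// ge0_ler_powR ?nnegrE ?Mp_ge0 ?hardy_norm_ge0 ?Mp_le_norm//.
exact: (le_trans _ p1).
Qed.

Lemma hardy_shift_leaf (R : realType) (p : R) (p1 : 1 <= p) (T : rootedTree)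
    (B : shift_invariant T p) (F : littleHardy T p1) (v : T) :
  leaf v -> hardy_val (hardy_shift p1 B F) v = 0.
Proof.
by move=> v0; rewrite /= /backward_shift v0 fset_set0 big_seq_fset0.
Qed.

Lemma hardy_shift_iter_leaf (R : realType) (p : R) (p1 : 1 <= p)
    (T : rootedTree) (B : shift_invariant T p) (F : littleHardy T p1) (v : T)
    (n : nat) :
  leaf v ->
  hardy_val (iter n (hardy_shift p1 B) F) v =
    if n == 0%N then hardy_val F v else 0.
Proof. by case: n => [//|n] /hardy_shift_leaf; rewrite iterS; apply. Qed.

Theorem proposition4p3p1 (R : realType) (p : R) (p1 : 1 <= p) (T : rootedTree)
    (B_inv : shift_invariant T p)
    (B_bounded : bounded_operator (littleHardy T p1) (hardy_shift p1 B_inv)) :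
  (exists v : T, leaf v) ->
  ~ hypercyclic (littleHardy T p1) (hardy_shift p1 B_inv).
Proof.
move=> [v vleaf] [F dF].
pose g : R := (gamma T (depth v))%:R.
(* [k] is at distance at least [1 + g] from both 0 and [F v], whereas a function
   of norm less than 1 has a value at [v] whose [p]-th power is at most [g]. *)
pose k : R[i] := (1 + g + normc (hardy_val F v))%:C%C.
pose E : littleHardy T p1 :=
  LittleHardy p1 (vertex_indicator_in_hardy0 p1 v).
have [|G [EG [n _ nG]]] := dF (ball (k *: E) 1) _ (ball_open _ _).
  by exists (k *: E); exact: ballxx.
have {}EG : hardy_norm p (k *: E - G) < 1.
  by move: EG; rewrite -ball_normE /= hardy_normE -[1]/(1%:C)%C ltcR.
have Gv : hardy_val G v = if n == 0%N then hardy_val F v else 0.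
  by rewrite -nG; exact: hardy_shift_iter_leaf.
have far : 1 + g <= normc (k - hardy_val G v).
  have nk : normc k = 1 + g + normc (hardy_val F v).
    by rewrite /k /= expr0n addr0 sqrtr_sqr ger0_norm// !addr_ge0 ?normc_ge0.
  rewrite Gv; case: (n == 0%N); last by rewrite subr0 nk lerDl normc_ge0.
  have : normc (k - hardy_val F v + hardy_val F v) <=
      normc (k - hardy_val F v) + normc (hardy_val F v) by exact: le_normcD.
  by rewrite subrK nk lerD2r.
have := normc_powR_hardy_norm (k *: E - G) v; apply/negP; rewrite -ltNge.
have -> : hardy_val (k *: E - G) v = k - hardy_val G v.
  by rewrite -[LHS]/(k * (v == v)%:R - hardy_val G v) eqxx mulr1.
apply: (@le_lt_trans _ _ g).
  have p0 : 0 <= p by exact: (le_trans _ p1).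
  rewrite ler_piMr ?ler0n// -[leRHS](congr1 (@^~ p) (powR1 R)).
  by rewrite ge0_ler_powR ?nnegrE ?hardy_norm_ge0// ltW.
apply: (@lt_le_trans _ _ (1 + g)); first by rewrite ltrDr.
have n1 : 1 <= normc (k - hardy_val G v).
  by apply: le_trans far; rewrite lerDl ler0n.
(* The base is at least 1, so raising it to a power [p >= 1] enlarges it. *)
apply: le_trans far _.
by rewrite -[leLHS]powRr1 ?ler_powR// normc_ge0.
Qed.
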